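(* For any $c>0$, any $N$ and sufficiently large $K$ (where $K$ may be finite or $K=\infty$), there exists a non-empty and open subset of the problem space $\mathcal P=\mathcal P_{N,K}$ on which $$n^{\mathrm{GBS\text{-}P}}_{\mathrm{Haf}}\le c\,n^{\mathrm{MC}}_{\mathrm{Haf}}<\infty$$ holds for all $0<\epsilon,\delta<1$.
   Context: $\mathbb{N}=\{0,1,2,\dots\}$; $N\ge1$ is an integer and $K\in\mathbb{N}\cup\{\infty\}$. For $I=(i_1,\dots,i_N)\in\mathbb{N}^N$: $|I|=i_1+\cdots+i_N$, $I!=i_1!\cdots i_N!$. Sums over $0\le k\le K$ run over all $k\in\mathbb N$ when $K=\infty$. Hafnian: for a $2m\times 2m$ matrix $M$, $m\ge 1$, $\mathrm{Haf}(M)=\frac{1}{m!2^m}\sum_{\sigma\in S_{2m}}\prod_{j=1}^m M_{\sigma(2j-1),\sigma(2j)}$; the hafnian of the empty matrix is $1$. For an $N\times N$ matrix $B$ and $I\in\mathbb{N}^N$, $B_I$ is the $|I|\times|I|$ matrix obtained from $B$ by repeating the $n$-th row and the $n$-th column $i_n$ times each (deleting them if $i_n=0$). Problem space. Let $\mathcal I_k=\{I\in\mathbb{N}^N:|I|=2k\}$ and $\mathcal A=\prod_{k=0}^K\mathbb{R}_{\ge0}^{\mathcal I_k}$ with the product topology of the usual topologies, and let $\mathcal B$ be the set of symmetric $N\times N$ real matrices with all entries strictly positive and all eigenvalues strictly between $0$ and $1$. For $B\in\mathcal B$ let $\mathcal A_B\subseteq\mathcal A$ be the subspace of all $(a_I)\in\mathcal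 A$ such that $$0\ne\sum_{k=0}^K\sum_{|I|=2k}a_I\mathrm{Haf}(B_I)<\infty,\qquad \sum_{k=0}^K\sum_{|I|=2k}a_I\,I!\,\mathrm{Haf}(B_I)<\infty,\qquad \sum_{k_1,k_2=0}^K\ \sum_{|I|=2k_1,\,|J|=2k_2}a_Ia_J\,\mathrm{Haf}(B_{I+J})<\infty$$ (the finiteness conditions are automatic when $K<\infty$). The problem space is $\mathcal P=\bigcup_{B\in\mathcal B}\mathcal A_B\subseteq\mathcal A\times\mathcal B$, i.e. the set of pairs $((a_I),B)$ with $B\in\mathcal B$ and $(a_I)\in\mathcal A_B$, with the subspace topology. For $((a_I),B)\in\mathcal P$ set $$\mu=\sum_{k=0}^K\sum_{|I|=2k}a_I\mathrm{Haf}(B_I),\qquad Q^{\mathrm{GBS\text{-}P}}=\frac{\mu}d\sum_{k=0}^K\sum_{|J|=2k}\frac{a_J\,J!}{\mathrm{Haf}(B_J)},\qquad Q^{\mathrm{MC}}=\sum_{k_1,k_2=0}^K\ \sum_{|I|=2k_1,\,|J|=2k_2}a_Ia_J\,\mathrm{Haf}(B_{I+J}),$$ where $d=\prod_{j=1}^N\sqrt{1-\lambda_j^2}$ with $\lambda_1,\dots,\lambda_N$ the eigenvalues of $B$, and for $0<\epsilon,\delta<1$ $$n^{\mathrm{GBS\text{-}P}}_{\mathrm{Haf}}=\frac{Q^{\mathrm{GBS\text{-}P}}-\mu^2}{\delta\epsilon^2\mu^2},\qquad n^{\mathrm{MC}}_{\mathrm{Haf}}=\frac{Q^{\mathrm{MC}}-\mu^2}{\delta\epsilon^2\mu^2}.$$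 These are the guaranteed sample sizes, for approximating $\mu$ with multiplicative error $\epsilon$ and failure probability $\delta$, of the probability estimator using Gaussian Boson Sampling samples and of the plain Monte Carlo estimator. *)

(* Defs.v *)
From HB Require Import structures.
From mathcomp Require Import all_boot all_order all_algebra all_fingroup.
From mathcomp Require Import all_classical all_reals all_analysis.

Set Implicit Arguments.
Unset Strict Implicit.
Unset Printing Implicit Defensive.

Import Order.TTheory GRing.Theory Num.Theory.
Import numFieldNormedType.Exports.

Local Open Scope classical_set_scope.
Local Open Scope ring_scope.

(* The cutoff K ranges over nat + {oo}; None stands for K = oo. *)
Definition le_cutoff (k : nat) (K : option nat) : bool :=
  if K is Some m then (k <= m)%N else true.

Section MultiIndices.
Variable N : nat.
Implicit Types I J : {ffun 'I_N -> nat}.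

Definition mi_deg I : nat := (\sum_i I i)%N.
Definition mi_fact I : nat := (\prod_i (I i)`!)%N.
Definition mi_add I J : {ffun 'I_N -> nat} := [ffun i => (I i + J i)%N].

(* |I| = 2k for some k <= K. *)
Definition even_upto (K : option nat) I : bool :=
  ~~ odd (mi_deg I) && le_cutoff (mi_deg I)./2 K.

(* The disjoint union of the index sets {I | |I| = 2k} over 0 <= k <= K.  All
   series below have nonnegative terms, so they are taken as unordered sums
   [\esum] over this type. *)
Definition mindex (K : option nat) : choiceType :=
  {I : {ffun 'I_N -> nat} | even_upto K I}.

(* Each index i repeated (I i) times, in increasing order. *)
Definition mi_seq I : seq 'I_N := flatten [seq nseq (I i) i | i <- enum 'I_N].

Lemma size_mi_seq I : size (mi_seq I) == mi_deg I.
Proof.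
rewrite size_flatten /shape -map_comp sumnE big_map big_enum /=.
by apply/eqP/eq_bigr => i _; rewrite size_nseq.
Qed.

Definition mi_tuple I : (mi_deg I).-tuple 'I_N := Tuple (size_mi_seq I).

End MultiIndices.

Section Hafnian.

Lemma pair_fst_subproof n (j : 'I_n./2) : (j.*2 < n)%N.
Proof. by rewrite ltnW // -gtn_half_double. Qed.

Lemma pair_snd_subproof n (j : 'I_n./2) : (j.*2.+1 < n)%N.
Proof. by rewrite -gtn_half_double. Qed.

Definition pair_fst n (j : 'I_n./2) : 'I_n := Ordinal (pair_fst_subproof j).
Definition pair_snd n (j : 'I_n./2) : 'I_n := Ordinal (pair_snd_subproof j).

(* Only used for n = 2m even (m = n./2); for n = 0 the value is 1.
   Writing the size as n rather than m.*2 avoids casts in [haf_rep]. *)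
Definition haf (R : realType) (n : nat) (M : 'M[R]_n) : R :=
  ((n./2)`! * 2 ^ n./2)%:R^-1 *
  \sum_(s : 'S_n) \prod_(j < n./2) M (s (pair_fst j)) (s (pair_snd j)).

(* B_I *)
Definition rep_mx (R : realType) (N : nat) (B : 'M[R]_N)
    (I : {ffun 'I_N -> nat}) : 'M[R]_(mi_deg I) :=
  mxsub (tnth (mi_tuple I)) (tnth (mi_tuple I)) B.

(* Haf(B_I) *)
Definition haf_rep (R : realType) (N : nat) (B : 'M[R]_N)
  (I : {ffun 'I_N -> nat}) : R := haf (rep_mx B I).

End Hafnian.

Section Problem.
Variables (R : realType) (N : nat) (K : option nat).
Local Open Scope ereal_scope.

Definition coef_space := {ptws mindex N K -> R}.

Implicit Types (a : coef_space) (B : 'M[R]_N).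

Definition admissible B : Prop :=
  [/\ B^T = B, (forall i j, (0 < B i j)%R)
    & (forall l : R, eigenvalue B l -> (0 < l < 1)%R)].

(* The eigenvalues listed with multiplicity.  For symmetric B such a list
   exists by the spectral theorem, and it is unique up to permutation. *)
Definition spectrum B : seq R :=
  xget [::] [set s | char_poly B = (\prod_(l <- s) ('X - l%:P))%R].

Definition dfactor B : R := (\prod_(l <- spectrum B) Num.sqrt (1 - l ^+ 2))%R.

Definition mu a B : \bar R :=
  \esum_(I in [set: mindex N K]) (a I * haf_rep B (val I))%:E.

Definition sum_fact a B : \bar R :=
  \esum_(I in [set: mindex N K])
    (a I * (mi_fact (val I))%:R * haf_rep B (val I))%:E.

Definition QMC a B : \bar R :=
  \esum_(IJ in [set: mindex N K * mindex N K])
    (a IJ.1 * a IJ.2 * haf_rep B (mi_add (val IJ.1) (val IJ.2)))%:E.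

Definition QGBSP a B : \bar R :=
  mu a B * (dfactor B)^-1%:E *
  \esum_(J in [set: mindex N K])
    (a J * (mi_fact (val J))%:R / haf_rep B (val J))%:E.

(* The topology of [coef_space * 'M[R]_N] is the product topology. *)
Definition problem_space : set (coef_space * 'M[R]_N) :=
  [set aB | [/\ admissible aB.2, (forall I, (0 <= aB.1 I)%R),
                mu aB.1 aB.2 != 0 /\ mu aB.1 aB.2 < +oo,
                sum_fact aB.1 aB.2 < +oo
              & QMC aB.1 aB.2 < +oo]].

Definition sample_size (Q m : \bar R) (eps delta : R) : \bar R :=
  (Q - m ^+ 2) / ((delta * eps ^+ 2)%:E * m ^+ 2).

(* Extended-real valued: [QGBSP] may be infinite when K = oo. *)
Definition nGBSP a B (eps delta : R) : \bar R :=
  sample_size (QGBSP a B) (mu a B) eps delta.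

Definition nMC a B (eps delta : R) : \bar R :=
  sample_size (QMC a B) (mu a B) eps delta.

End Problem.

Arguments problem_space : clear implicits.

(* Main.v *)
Require Import Defs.
From mathcomp Require Import all_boot all_order all_algebra all_fingroup.
From mathcomp Require Import all_classical all_reals all_analysis.
From mathcomp Require Import ring lra.

Set Implicit Arguments.
Unset Strict Implicit.
Unset Printing Implicit Defensive.

Import Order.TTheory GRing.Theory Num.Theory.
Import numFieldNormedType.Exports.

Local Open Scope classical_set_scope.
Local Open Scope ring_scope.

(** Write [h_I = Haf(B_I)].  Since [Q^MC] dominates each of its diagonal terms
    [a_I^2 h_{2I}], one has [a_I I!/h_I <= sqrt(Q^MC) t_I] with
    [t_I = I!/(h_I sqrt(h_{2I}))].  If the diagonal of [B] is close to 1 and its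
    off-diagonal entries are small but positive, [t_I] decays geometrically in [|I|],
    so the high-degree part of [sum_I a_I I!/h_I] is at most a small multiple of
    [sqrt(Q^MC)], however large the coefficients are; this matters because an open
    set of the product topology constrains only finitely many of them.  The
    low-degree part is made small by requiring those coefficients to be small compared
    with a single coefficient of high degree.  As [h_I^2 <= I!], [mu] obeys the same
    bound, whence [mu^2 <= Q^MC] and [Q^GBS-P <= min(c,1) Q^MC].

    The two bounds on [h_I] come from the recursion that removes one pair of indices:
    an upper bound [sqrt(I!)] when the row sums are at most 1, and a lower bound by a
    product over [k] of factors depending on [I_k] only. *)

(** * Sums over pairings *)

(** A permutation of n + 1 points amounts to the image [p] of the first point and a permutation of
    the rest; injectivity of this encoding suffices, both sides having (n + 1)! elements. *)
Lemma big_perm_lift (V : nmodType) n (F : 'S_n.+1 -> V) :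
  \sum_(s : 'S_n.+1) F s = \sum_(p < n.+1) \sum_(s : 'S_n) F (lift_perm ord0 p s).
Proof.
rewrite pair_big /= (reindex (fun ps : 'I_n.+1 * 'S_n => lift_perm ord0 ps.1 ps.2)) //=.
apply: onW_bij; apply: inj_card_bij => [[p s] [q t] /= st|].
  have pq : p = q by have := congr1 (fun u : 'S_n.+1 => u ord0) st; rewrite !lift_perm_id.
  rewrite -pq in st *; congr pair; apply/permP => k.
  have := congr1 (fun u : 'S_n.+1 => u (lift ord0 k)) st.
  by rewrite !lift_perm_lift => /lift_inj.
by rewrite card_prod card_ord !card_Sn factS.
Qed.

Section Occurrences.
Variable N : nat.

Definition occ n (x : 'I_n -> 'I_N) (i : 'I_N) : nat := \sum_(p < n) (x p == i).

Definition incr (i : 'I_N) (J : 'I_N -> nat) (k : 'I_N) : nat := (i == k) + J k.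

Lemma sum_by_occ (R : pzSemiRingType) n (x : 'I_n -> 'I_N) (g : 'I_N -> R) :
  \sum_(p < n) g (x p) = \sum_i (occ x i)%:R * g i.
Proof.
under [RHS]eq_bigr do rewrite /occ natr_sum big_distrl /=.
rewrite exchange_big /=; apply: eq_bigr => p _.
rewrite (bigD1 (x p)) //= eqxx mul1r big1 ?addr0 // => i /negPf.
by rewrite eq_sym => ->; rewrite mul0r.
Qed.

Lemma occ_lift n (x : 'I_n.+1 -> 'I_N) (p : 'I_n.+1) :
  occ x =1 incr (x p) (occ (x \o lift p)).
Proof. by move=> k; rewrite /occ /incr (bigD1_ord p). Qed.

Lemma sum_occ n (x : 'I_n -> 'I_N) : \sum_i occ x i = n.
Proof.
rewrite exchange_big /= -[RHS]card_ord -sum1_card; apply: eq_bigr => p _.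
by rewrite (bigD1 (x p)) //= eqxx big1 // => i /negPf; rewrite eq_sym => ->.
Qed.

Lemma prod_incr (R : comPzSemiRingType) (f : nat -> R) i (J : 'I_N -> nat) :
  (\prod_k f (incr i J k)) * f (J i) = (\prod_k f (J k)) * f (J i).+1.
Proof.
rewrite (bigD1 i) //= [in RHS](bigD1 i) //= /incr eqxx add1n.
rewrite mulrAC [RHS]mulrAC [X in X * _]mulrC; congr (_ * _).
by apply: eq_bigr => k /negPf; rewrite eq_sym => ->.
Qed.

End Occurrences.

Section PairingSum.
Variables (R : rcfType) (N : nat) (B : 'M[R]_N).

(** The hafnian before normalisation. Indexing by a function [x] on positions turns the removal of a
    position into composition with [lift]. *)
Definition pairing_sum n (x : 'I_n -> 'I_N) : R :=
  \sum_(s : 'S_n) \prod_(j < n./2) B (x (s (pair_fst j))) (x (s (pair_snd j))).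

Lemma pairing_sum0 (x : 'I_0 -> 'I_N) : pairing_sum x = 1.
Proof.
rewrite /pairing_sum (eq_bigr (fun=> 1)) => [|s _]; last by rewrite big_ord0.
by rewrite sumr_const card_Sn.
Qed.

(** The first pair of the permutation occupies the positions [p] and [lift p q]; what remains is a
    permutation of the other [n] positions. *)
Lemma pairing_sumSS n (x : 'I_n.+2 -> 'I_N) :
  pairing_sum x = \sum_(p < n.+2) \sum_(q < n.+1)
    B (x p) (x (lift p q)) * pairing_sum (x \o lift p \o lift q).
Proof.
rewrite /pairing_sum big_perm_lift; apply: eq_bigr => p _.
rewrite big_perm_lift; apply: eq_bigr => q _.
rewrite big_distrr /=; apply: eq_bigr => s _.
rewrite big_ord_recl; congr (B (x _) (x _) * _).
- rewrite -[RHS](lift_perm_id ord0 p (lift_perm ord0 q s)); congr (lift_perm _ _ _ _).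
  exact: val_inj.
- rewrite -[q in RHS](lift_perm_id ord0 q s) -(lift_perm_lift ord0); congr (lift_perm _ _ _ _).
  exact: val_inj.
apply: eq_bigr => j _; congr (B (x _) (x _)).
all: rewrite -!(lift_perm_lift ord0); congr (lift_perm _ _ _ _); exact: val_inj.
Qed.

End PairingSum.

(** * Upper bound on the pairing sum by AM-GM *)

Section UpperBound.
Variables (R : rcfType) (N : nat) (B : 'M[R]_N).

(** For even [n] this is the double factorial n!!. *)
Definition pairing_norm n : R := ((n./2)`! * 2 ^ n./2)%:R.

Lemma pairing_norm_gt0 n : 0 < pairing_norm n.
Proof. by rewrite ltr0n muln_gt0 fact_gt0 expn_gt0. Qed.

Lemma pairing_normSS n : ~~ odd n -> pairing_norm n.+2 = n.+2%:R * pairing_norm n.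
Proof.
move=> en; rewrite /pairing_norm /= factS expnS -natrM; congr (_%:R).
have -> : n.+2 = (2 * (n./2).+1)%N by rewrite mul2n doubleS even_halfK.
by set a := _`!; set b := (2 ^ _)%N; set m := _.+1; ring.
Qed.

Definition sqrt_fact k : R := Num.sqrt k`!%:R.

Lemma prod_sqrt_fact n (x : 'I_n.+1 -> 'I_N) p :
  \prod_k sqrt_fact (occ x k) =
  Num.sqrt (occ x (x p))%:R * \prod_k sqrt_fact (occ (x \o lift p) k).
Proof.
set J := occ (x \o lift p).
have f_gt0 k : 0 < sqrt_fact k by rewrite sqrtr_gt0 ltr0n fact_gt0.
have -> : \prod_k sqrt_fact (occ x k) = \prod_k sqrt_fact (incr (x p) J k).
  by apply: eq_bigr => k _; rewrite (occ_lift x p).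
rewrite (occ_lift x p) /incr eqxx add1n.
apply: (mulIf (lt0r_neq0 (f_gt0 (J (x p))))); rewrite prod_incr.
by rewrite /sqrt_fact factS natrM sqrtrM ?ler0n // mulrA; congr (_ * _); exact: mulrC.
Qed.

Hypotheses (B_ge0 : forall i j, 0 <= B i j) (B_row : forall i, \sum_j B i j <= 1)
  (B_col : forall j, \sum_i B i j <= 1).

(** Removing a pair with values i, j divides the bound by sqrt(I_i J_j), where J is I without the
    first of the two. AM-GM makes the sum over partners linear in the multiplicities; row and column
    sums at most 1 then bound the total by the length of [x], the factor in [pairing_normSS]. *)
Lemma pairing_sum_le n (x : 'I_n -> 'I_N) : ~~ odd n ->
  pairing_sum B x <= pairing_norm n * \prod_k sqrt_fact (occ x k).
Proof.
elim/ltn_ind: n x => -[|[|n]] // IH x en.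
  rewrite pairing_sum0 /pairing_norm mul1r big1 // => k _.
  by rewrite /occ big_ord0 /sqrt_fact sqrtr1.
have {en} en : ~~ odd n by rewrite /= negbK in en.
rewrite pairing_sumSS pairing_normSS //.
set P := \prod_k _; pose I := occ x.
have P_ge0 : 0 <= P by apply: prodr_ge0 => k _; exact: sqrtr_ge0.
have I_gt0 p : (0 < I (x p))%N by rewrite /I (occ_lift x p) /incr eqxx.
(* Using [I] instead of the multiplicities left after deleting [p] makes the bound depend on [p]
   only through [x p]. *)
pose g i := \sum_j B i j * ((I j)%:R / (I i)%:R + 1) / 2.
have step p : \sum_(q < n.+1) B (x p) (x (lift p q)) *
    pairing_sum B (x \o lift p \o lift q) <= pairing_norm n * P * g (x p).
  pose J := occ (x \o lift p).
  have J_gt0 q : (0 < J (x (lift p q)))%N.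
    by rewrite /J (occ_lift (x \o lift p) q) /incr eqxx.
  apply: (@le_trans _ _ (\sum_(q < n.+1) pairing_norm n * P *
     (B (x p) ((x \o lift p) q) /
       (Num.sqrt (I (x p))%:R * Num.sqrt (J ((x \o lift p) q))%:R)))).
    apply: ler_sum => q _; apply: (le_trans (ler_wpM2l (B_ge0 _ _) (IH n _ _ en))) => //.
    rewrite /P (prod_sqrt_fact x p) (prod_sqrt_fact (x \o lift p) q) /=.
    rewrite le_eqVlt; apply/orP; left; apply/eqP; rewrite -/I -/J.
    have : Num.sqrt (I (x p))%:R != 0 :> R by rewrite gt_eqF // sqrtr_gt0 ltr0n.
    have : Num.sqrt (J (x (lift p q)))%:R != 0 :> R by rewrite gt_eqF // sqrtr_gt0 ltr0n.
    by move=> ? ?; field; apply/andP.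
  rewrite -big_distrr /=; apply: ler_wpM2l; first by rewrite mulr_ge0 // ltW ?pairing_norm_gt0.
  rewrite (sum_by_occ (x \o lift p)
    (fun j => B (x p) j / (Num.sqrt (I (x p))%:R * Num.sqrt (J j)%:R))).
  apply: ler_sum => j _; rewrite -/J.
  have leJ : (J j)%:R <= (I j)%:R :> R.
    by rewrite ler_nat /I (occ_lift x p) /incr leq_addl.
  have [->|Jj] := posnP (J j).
    by rewrite mul0r divr_ge0 ?mulr_ge0 ?addr_ge0 ?divr_ge0 ?ler0n ?ler01.
  have a_gt0 : 0 < Num.sqrt (I (x p))%:R :> R by rewrite sqrtr_gt0 ltr0n.
  have b_gt0 : 0 < Num.sqrt (J j)%:R :> R by rewrite sqrtr_gt0 ltr0n.
  have aE : (I (x p))%:R = Num.sqrt (I (x p))%:R ^+ 2 :> R by rewrite sqr_sqrtr.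
  have bE : (J j)%:R = Num.sqrt (J j)%:R ^+ 2 :> R by rewrite sqr_sqrtr.
  rewrite mulrCA -mulrA ler_wpM2l //.
  apply: (@le_trans _ _ (((J j)%:R / (I (x p))%:R + 1) / 2)); last first.
    by rewrite ler_pM2r ?invr_gt0 ?ltr0n // lerD2r ler_pM2r // invr_gt0 ltr0n.
  rewrite {1 3}bE {2}aE.
  set a := Num.sqrt _ in a_gt0 *; set b := Num.sqrt _ in b_gt0 *.
  (* AM-GM: [b / a <= (b^2 / a^2 + 1) / 2] *)
  have -> : b ^+ 2 / (a * b) = b / a by field; rewrite !gt_eqF.
  have -> : (b ^+ 2 / a ^+ 2 + 1) / 2 = b / a + (b / a - 1) ^+ 2 / 2 by field; rewrite !gt_eqF.
  by rewrite lerDl divr_ge0 ?sqr_ge0.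
apply: (le_trans (ler_sum _ (fun p _ => step p))).
rewrite -big_distrr /= -[leRHS]mulrA [leRHS]mulrC.
rewrite ler_wpM2l ?mulr_ge0 ?(ltW (pairing_norm_gt0 _)) //.
rewrite sum_by_occ -/I.
apply: (@le_trans _ _ (\sum_i \sum_j B i j * ((I j)%:R + (I i)%:R) / 2)).
  apply: ler_sum => i _; rewrite /g big_distrr /=; apply: ler_sum => j _.
  have [->|Ii] := posnP (I i).
    by rewrite mul0r; apply: divr_ge0; rewrite ?mulr_ge0 ?addr_ge0 ?ler0n.
  rewrite le_eqVlt; apply/orP; left; apply/eqP; field.
  by rewrite pnatr_eq0 -lt0n.
have sumI : \sum_i (I i)%:R = n.+2%:R :> R by rewrite -natr_sum sum_occ.
rewrite -sumI [X in _ <= X]splitr [X in _ <= X + _]big_distrl [X in _ <= _ + X]big_distrl /=.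
under eq_bigr => i _ do under eq_bigr => j _ do rewrite mulrDr mulrDl.
under eq_bigr => i _ do rewrite big_split /=.
(* The half with [I j] is bounded by column sums, the half with [I i] by row sums. *)
rewrite big_split /= lerD //.
  rewrite exchange_big /=; apply: ler_sum => i _; rewrite -big_distrl -big_distrl /=.
  by rewrite ler_pM2r ?invr_gt0 ?ltr0n // ler_piMl.
apply: ler_sum => i _; rewrite -big_distrl -big_distrl /=.
by rewrite ler_pM2r ?invr_gt0 ?ltr0n // ler_piMl.
Qed.
End UpperBound.

(** * Lower bound on the pairing sum by a product of one-index weights *)

Section LowerBound.
Variables (R : rcfType) (N : nat) (B : 'M[R]_N) (beta eps : R).

(* [dfact_pred n] is (n - 1)!! *)
Fixpoint dfact_pred n : nat :=
  match n with n'.+2 => n'.+1 * dfact_pred n' | _ => 1 end.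

Lemma dfact_pred_gt0 n : (0 < dfact_pred n)%N.
Proof. by elim/ltn_ind: n => -[|[|n]] //= IH; rewrite muln_gt0 /= IH. Qed.

Lemma dfact_pred_leS n : (dfact_pred n <= dfact_pred n.+1)%N.
Proof.
elim/ltn_ind: n => -[|[|n]] // IH.
by rewrite [dfact_pred n.+2]/= [dfact_pred n.+3]/= leq_mul // IH.
Qed.

Lemma dfact_predS_le n : (dfact_pred n.+1 <= n.+1 * dfact_pred n)%N.
Proof. 
case: n => [|n] //; rewrite [dfact_pred n.+2]/= leq_mul //.
exact: dfact_pred_leS.
Qed.

Lemma fact_dfact_pred n : n`! = (dfact_pred n * dfact_pred n.+1)%N.
Proof. by elim: n => // n IH; rewrite factS IH mulnA mulnC. Qed.

(* Chosen so that [haf_weight n.+2 = beta^2 (n + 1) haf_weight n], which matches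
   pairing an index with another copy of itself; an odd multiplicity leaves one copy
   that must be paired through an off-diagonal entry, at the cost of [eps]. *)
Definition haf_weight n : R := eps ^+ odd n * beta ^+ n * (dfact_pred n)%:R.

Hypotheses (eps_gt0 : 0 < eps) (eps_le1 : eps <= 1)
  (beta_gt0 : 0 < beta) (beta_le1 : beta <= 1).

Lemma haf_weight_gt0 n : 0 < haf_weight n.
Proof. by rewrite !mulr_gt0 ?exprn_gt0 // ltr0n dfact_pred_gt0. Qed.

Lemma haf_weightSS n : haf_weight n.+2 = beta ^+ 2 * n.+1%:R * haf_weight n.
Proof. by rewrite /haf_weight /= negbK natrM !exprS; ring. Qed.

Lemma prod_haf_weight n (x : 'I_n.+1 -> 'I_N) p (J := occ (x \o lift p)) :
  \prod_k haf_weight (occ x k) =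
  haf_weight (J (x p)).+1 / haf_weight (J (x p)) * \prod_k haf_weight (J k).
Proof.
have -> : \prod_k haf_weight (occ x k) = \prod_k haf_weight (incr (x p) J k).
  by apply: eq_bigr => k _; rewrite (occ_lift x p).
have h0 := lt0r_neq0 (haf_weight_gt0 (J (x p))).
by apply: (mulIf h0); rewrite prod_incr mulrAC divfK // mulrC.
Qed.

Hypotheses (B_diag : forall i, beta <= B i i) (B_ge : forall i j, eps <= B i j).

(** For each position [p] of the first index, a single partner value already contributes enough;
    summing over [p] supplies the factor in [pairing_normSS]. *)
Lemma pairing_sum_ge n (x : 'I_n -> 'I_N) : ~~ odd n ->
  pairing_norm R n * \prod_k haf_weight (occ x k) <= pairing_sum B x.
Proof.
have B_ge0 i j : 0 <= B i j by exact: le_trans (ltW eps_gt0) (B_ge i j).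
elim/ltn_ind: n x => -[|[|n]] // IH x en.
  rewrite pairing_sum0 /pairing_norm mul1r big1 // => k _.
  by rewrite /occ big_ord0 /haf_weight !mul1r.
have {en} en : ~~ odd n by rewrite /= negbK in en.
rewrite pairing_sumSS pairing_normSS //.
set P := \prod_k _.
have step p : pairing_norm R n * P <= \sum_(q < n.+1) B (x p) (x (lift p q)) *
    pairing_sum B (x \o lift p \o lift q).
  pose J := occ (x \o lift p).
  have J_gt0 q : (0 < J (x (lift p q)))%N.
    by rewrite /J (occ_lift (x \o lift p) q) /incr eqxx.
  pose f := \prod_k haf_weight (J k).
  have f_gt0 : 0 < f by apply: prodr_gt0 => k _; exact: haf_weight_gt0.
  pose g j := pairing_norm R n * f * (B (x p) j * (haf_weight (J j).-1 / haf_weight (J j))).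
  have g_ge0 j : 0 <= g j.
    apply: mulr_ge0; first by rewrite ltW // mulr_gt0 ?pairing_norm_gt0.
    by apply: mulr_ge0 => //; rewrite ltW // divr_gt0 ?haf_weight_gt0.
  apply: (@le_trans _ _ (\sum_(q < n.+1) g ((x \o lift p) q))); last first.
    apply: ler_sum => q _.
    apply: le_trans (ler_wpM2l (B_ge0 _ _) (IH n _ _ en)) => //.
    rewrite /g /f (prod_haf_weight (x \o lift p) q) /=.
    have -> : J (x (lift p q)) = (occ (x \o lift p \o lift q) (x (lift p q))).+1.
      by rewrite /J (occ_lift (x \o lift p) q) /incr eqxx.
    rewrite /=; set a := occ _ _; set h := \prod_k _.
    rewrite le_eqVlt; apply/orP; left; apply/eqP; field.
    by rewrite !gt_eqF ?haf_weight_gt0.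
  rewrite (sum_by_occ (x \o lift p) g) -/J.
  suff [j hj] : exists j, haf_weight (J (x p)).+1 / haf_weight (J (x p)) <=
      (J j)%:R * (B (x p) j * (haf_weight (J j).-1 / haf_weight (J j))).
    rewrite (bigD1 j) //= -[X in X <= _]addr0 lerD //; last first.
      by apply: sumr_ge0 => k _; rewrite mulr_ge0.
    rewrite /g mulrCA -mulrA ler_wpM2l ?(ltW (pairing_norm_gt0 _ _)) //.
    by rewrite /P (prod_haf_weight x p) -/J -/f mulrC ler_wpM2l // ltW.
  (* Pair [x p] with another copy of itself if there is one, else with some index of
     odd multiplicity, which exists by parity. *)
  case Ji : (J (x p)) => [|k]; last first.
    (* After [haf_weightSS] only beta^2 <= B i i is left, for i = [x p]. *)
    exists (x p); rewrite Ji haf_weightSS /=.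
    rewrite mulrA [X in _ <= X]mulrA ler_pM2r ?invr_gt0 ?haf_weight_gt0 //.
    rewrite (ler_pM2r (haf_weight_gt0 _)) mulrC ler_wpM2l ?ler0n //.
    apply: le_trans (B_diag _); rewrite expr2; exact: ler_piMr (ltW _) _.
  have [j oj] : exists j, odd (J j).
    case: (pickP (fun j => odd (J j))) => [j oj|eJ]; first by exists j.
    have : odd (\sum_j J j) by rewrite sum_occ /= en.
    suff -> : odd (\sum_j J j) = false by [].
    by apply: (big_ind (fun m => odd m = false)) => // a b; rewrite oddD => -> ->.
  exists j; case: (J j) oj => [|l] //= el.
  have hl : ~~ odd l by [].
  rewrite {1 2}/haf_weight /= !mul1r !expr1 mulr1 divr1.
  rewrite /haf_weight /= el (negbTE hl) /= mul1r expr1 exprS.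
  have w0 : 0 < (dfact_pred l)%:R :> R by rewrite ltr0n dfact_pred_gt0.
  have w1 : 0 < (dfact_pred l.+1)%:R :> R by rewrite ltr0n dfact_pred_gt0.
  have b0 : 0 < beta ^+ l by rewrite exprn_gt0.
  have -> : l.+1%:R * (B (x p) j * (beta ^+ l * (dfact_pred l)%:R /
     (eps * (beta * beta ^+ l) * (dfact_pred l.+1)%:R))) =
     (B (x p) j / (eps * beta)) * ((l.+1%:R * (dfact_pred l)%:R) / (dfact_pred l.+1)%:R).
    by field; rewrite !gt_eqF.
  have eb0 : 0 < eps * beta by rewrite mulr_gt0.
  (* The number 1 separates the two sides: eps * beta <= 1, while both factors on the right are at
     least 1, as B >= eps >= eps * beta and l!! <= (l + 1) (l - 1)!!. *)
  apply: (@le_trans _ _ 1); first by rewrite mulr_ile1 // ltW.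
  apply: (@le_trans _ _ (1 * 1)); first by rewrite mulr1.
  apply: ler_pM => //; last first.
    by rewrite ler_pdivlMr // mul1r -natrM ler_nat dfact_predS_le.
  rewrite ler_pdivlMr // mul1r; apply: le_trans (B_ge _ _).
  by rewrite ler_piMr // ltW.
apply: le_trans (ler_sum _ (fun p _ => step p)).
by rewrite sumr_const card_ord -mulrA mulr_natl.
Qed.
End LowerBound.

(** * Bounds on [Haf(B_I)] *)

(** Passing from n to n + 2 multiplies n!!^2 by (n + 2)^2 and (2n - 1)!! by (2n + 1)(2n + 3),
    asymptotically four times as much. The rate 4/5 survives this step for n >= 1; the constant 3
    covers the initial cases 0, 1, 2. *)
Lemma dfact_pred_sqr_le (R : realFieldType) n :
  (dfact_pred n.+1)%:R ^+ 2 <= 3 * (4 / 5) ^+ n * (dfact_pred n.*2)%:R :> R.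
Proof.
elim/ltn_ind: n => n IH; case: n IH => [|[|[|n]]] IH.
- by change (1%:R ^+ 2 <= 3 * (4 / 5) ^+ 0 * 1%:R :> R); rewrite !exprS !expr0; lra.
- by change (1%:R ^+ 2 <= 3 * (4 / 5) ^+ 1 * 1%:R :> R); rewrite !exprS !expr0; lra.
- by change (2%:R ^+ 2 <= 3 * (4 / 5) ^+ 2 * 3%:R :> R); rewrite !exprS !expr0; lra.
have := IH n.+1 (ltnW (ltnSn _)).
have w_ge0 : 0 <= (dfact_pred n.+1.*2)%:R :> R by [].
have q_ge0 : 0 <= 3 * (4 / 5) ^+ n.+1 :> R by rewrite mulr_ge0 // exprn_ge0 //; lra.
have -> : (dfact_pred n.+4)%:R = n.+3%:R * (dfact_pred n.+2)%:R :> R by rewrite -natrM.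
have -> : (dfact_pred n.+3.*2)%:R =
    (n.*2.+4).+1%:R * (n.*2.+3%:R * (dfact_pred n.+1.*2)%:R) :> R by rewrite -!natrM.
move=> le2; rewrite exprMn [(4 / 5) ^+ n.+3]exprS [(4 / 5) ^+ n.+2]exprS.
apply: le_trans (ler_wpM2l (sqr_ge0 _) le2) _.
set q := (4 / 5) ^+ n.+1 in q_ge0 *; set w := (dfact_pred n.+1.*2)%:R in w_ge0 *.
have qw_ge0 : 0 <= 3 * q * w by rewrite mulr_ge0.
set c := (n.*2.+4).+1%:R; set d := n.*2.+3%:R.
have -> : 3 * (4 / 5 * (4 / 5 * q)) * (c * (d * w)) =
  (16 / 25 * c * d) * (3 * q * w) by field.
rewrite {}/c {}/d.
rewrite ler_wpM2r // -[(n.*2.+4).+1]addn1 -[n.*2.+4]addn4 -[n.*2.+3]addn3 -[n.+3]addn3.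
rewrite !natrD -muln2 natrM.
have : 0 <= n%:R :> R by [].
nra.
Qed.

Section HafBounds.
Variables (R : realType) (N : nat) (B : 'M[R]_N).
Implicit Type I : {ffun 'I_N -> nat}.

Lemma occ_mi_tuple I : occ (tnth (mi_tuple I)) =1 I.
Proof.
move=> i; rewrite /occ.
rewrite -(big_tuple _ _ (mi_tuple I) predT (fun k => nat_of_bool (k == i))) /=.
rewrite /mi_seq big_flatten big_map big_enum /= (bigD1 i) //= big_nseq big1 => [|k /negPf ki].
  by rewrite eqxx iter_addn_0 mul1n addn0.
by rewrite big_nseq ki iter_addn_0.
Qed.

Lemma haf_repE I :
  haf_rep B I = (pairing_norm R (mi_deg I))^-1 * pairing_sum B (tnth (mi_tuple I)).
Proof.
rewrite /haf_rep /haf; congr (_ * _); apply: eq_bigr => s _; apply: eq_bigr => j _.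
by rewrite mxE.
Qed.

Lemma haf_rep_sqr_le I : (forall i j, 0 <= B i j) -> (forall i, \sum_j B i j <= 1) ->
  (forall j, \sum_i B i j <= 1) -> ~~ odd (mi_deg I) ->
  0 <= haf_rep B I -> haf_rep B I ^+ 2 <= (mi_fact I)%:R.
Proof.
move=> B_ge0 rowB colB evI h_ge0; have := pairing_sum_le B_ge0 rowB colB (tnth (mi_tuple I)) evI.
rewrite -ler_pdivrMl ?pairing_norm_gt0 // -haf_repE => hle.
have -> : (mi_fact I)%:R = (\prod_k sqrt_fact R (occ (tnth (mi_tuple I)) k)) ^+ 2.
  rewrite -prodrXl /mi_fact natr_prod; apply: eq_bigr => k _.
  by rewrite occ_mi_tuple sqr_sqrtr.
by rewrite lerXn2r // nnegrE // (le_trans h_ge0).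
Qed.

Variables beta eps : R.
Hypotheses (eps_gt0 : 0 < eps) (eps_le1 : eps <= 1)
  (beta_gt0 : 0 < beta) (beta_le1 : beta <= 1).
Hypotheses (B_diag : forall i, beta <= B i i) (B_ge : forall i j, eps <= B i j).

Lemma haf_rep_ge I : ~~ odd (mi_deg I) ->
  \prod_k haf_weight beta eps (I k) <= haf_rep B I.
Proof.
move=> evI.
have := pairing_sum_ge eps_gt0 eps_le1 beta_gt0 beta_le1 B_diag B_ge
  (tnth (mi_tuple I)) evI.
rewrite -ler_pdivlMl ?pairing_norm_gt0 // -haf_repE.
by under eq_bigr do rewrite occ_mi_tuple.
Qed.

Lemma haf_rep_gt0 I : ~~ odd (mi_deg I) -> 0 < haf_rep B I.
Proof.
by move=> /haf_rep_ge; apply: lt_le_trans; apply: prodr_gt0 => k _; exact: haf_weight_gt0.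
Qed.

Lemma mi_deg_add I J : mi_deg (mi_add I J) = (mi_deg I + mi_deg J)%N.
Proof. by rewrite /mi_deg -big_split; apply: eq_bigr => i _; rewrite ffunE. Qed.

Hypothesis beta_big : 4 / 5 <= beta ^+ 8.

(** The quotient on the left is n!! / (eps^(odd n) beta^n), and the weight of 2n carries no [eps].
    After the double factorial bound, 3 (4/5)^n <= 4 beta^(8n) remains; this is the origin of
    [2 / eps] and of [beta_big]. *)
Lemma fact_haf_weight_sqr_le n :
  (n`!%:R / haf_weight beta eps n) ^+ 2 <=
  (2 / eps * beta ^+ n ^+ 2) ^+ 2 * haf_weight beta eps (n + n).
Proof.
have w_gt0 k : 0 < (dfact_pred k)%:R :> R by rewrite ltr0n dfact_pred_gt0.
have b_gt0 : 0 < beta ^+ n by rewrite exprn_gt0.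
rewrite fact_dfact_pred natrM /haf_weight oddD addbb expr0 mul1r addnn.
have -> : beta ^+ n.*2 = beta ^+ n ^+ 2 by rewrite -exprM muln2.
have e_ge : eps <= eps ^+ odd n by case: odd; rewrite ?expr1.
have e_gt0 : 0 < eps ^+ odd n by exact: lt_le_trans e_ge.
set e := eps ^+ odd n in e_ge e_gt0 *; set b := beta ^+ n in b_gt0 *.
have -> : (dfact_pred n)%:R * (dfact_pred n.+1)%:R / (e * b * (dfact_pred n)%:R) =
  (dfact_pred n.+1)%:R / (e * b) by field; rewrite !gt_eqF.
have -> : (2 / eps * b ^+ 2) ^+ 2 * (b ^+ 2 * (dfact_pred n.*2)%:R) =
   4 * b ^+ 8 * (dfact_pred n.*2)%:R / (eps * b) ^+ 2 by field; rewrite !gt_eqF.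
rewrite expr_div_n; apply: ler_pM; rewrite ?sqr_ge0 ?invr_ge0 ?sqr_ge0 //; last first.
  rewrite lef_pV2 ?posrE ?exprn_gt0 ?mulr_gt0 //.
  by rewrite lerXn2r ?nnegrE ?(ltW (mulr_gt0 _ _)) // ler_pM2r.
apply: le_trans (dfact_pred_sqr_le R n) _; rewrite ler_wpM2r ?(ltW (w_gt0 _)) //.
have bq : (4 / 5) ^+ n <= b ^+ 8.
  by rewrite /b exprAC lerXn2r ?nnegrE ?exprn_ge0 // ?(ltW beta_gt0) //; lra.
have : 0 <= (4 / 5 : R) ^+ n by rewrite exprn_ge0 //; lra.
by lra.
Qed.

(** The one-index bounds multiply to a bound on t_I. Of the two factors beta^|I|, one later gives
    smallness in high degree, the other convergence of the sum over I. *)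
Lemma haf_rep_ratio I : ~~ odd (mi_deg I) ->
  ((mi_fact I)%:R / haf_rep B I) ^+ 2 <=
  ((2 / eps) ^+ N * beta ^+ mi_deg I ^+ 2) ^+ 2 * haf_rep B (mi_add I I).
Proof.
move=> evI; have ev2 : ~~ odd (mi_deg (mi_add I I)) by rewrite mi_deg_add oddD addbb.
have hI := haf_rep_ge evI; have h2 := haf_rep_ge ev2.
have h_gt0 := haf_rep_gt0 evI.
have p_gt0 : 0 < \prod_k haf_weight beta eps (I k).
  by apply: prodr_gt0 => k _; exact: haf_weight_gt0.
apply: (@le_trans _ _ (((mi_fact I)%:R / \prod_k haf_weight beta eps (I k)) ^+ 2)).
  rewrite lerXn2r ?nnegrE ?divr_ge0 ?(ltW h_gt0) ?(ltW p_gt0) //.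
  by rewrite ler_wpM2l // lef_pV2 ?posrE.
apply: le_trans (ler_wpM2l (sqr_ge0 _) h2).
have -> : (2 / eps) ^+ N * beta ^+ mi_deg I ^+ 2 = \prod_k (2 / eps * beta ^+ I k ^+ 2).
  by rewrite big_split prodr_const card_ord prodrXl prodrXr.
rewrite /mi_fact natr_prod -prodf_div -!prodrXl -big_split /=.
apply: ler_prod => k _; rewrite sqr_ge0 /= ffunE; exact: fact_haf_weight_sqr_le.
Qed.
End HafBounds.

(** * Geometric domination and eigenvalues *)

Lemma esum_supp1 (R : realType) (T : choiceType) (x : T) (f : T -> R) : 0 <= f x ->
  (forall y, y != x -> f y = 0) -> \esum_(y in [set: T]) (f y)%:E = (f x)%:E.
Proof.
move=> fx_ge0 f0; rewrite -[RHS](@esum_set1 R T x (EFin \o f)) //= [RHS]esum_mkcond.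
apply: eq_esum => y _; rewrite in_set1; case: eqP => [-> //|/eqP /f0 ->//].
Qed.

(** Any finite family of multi-indices embeds into a box of exponents, where the sum of s^|I|
    factors into N partial geometric sums. *)
Lemma esum_geometric_le (R : realType) N K (s C : R) (f : mindex N K -> R) :
  0 < s < 1 -> 0 <= C ->
  (forall I, f I <= C * s ^+ mi_deg (val I)) ->
  (\esum_(I in [set: mindex N K]) (f I)%:E <= (C / (1 - s) ^+ N)%:E)%E.
Proof.
move=> /andP[s_gt0 s_lt1] C_ge0 f_le; apply: ge_ereal_sup => _ [F [finF _] <-].
rewrite fsumEFin // lee_fin fsbig_finite //=.
set r : seq (mindex N K) := (X in \sum_(i <- X) _).
have uniq_r : uniq r by exact: finmap.fset_uniq.
apply: le_trans (ler_sum _ (fun I _ => f_le I)) _; rewrite -big_distrr /= ler_wpM2l //.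
pose n := \max_(I <- r) mi_deg (val I).
pose h (I : mindex N K) : {ffun 'I_N -> 'I_n.+1} := [ffun i => inord (val I i)].
have hE I i : I \in r -> h I i = val I i :> nat.
  move=> Ir; rewrite ffunE inordK // ltnS (@leq_trans (mi_deg (val I))) //.
    by rewrite /mi_deg (bigD1 i) //= leq_addr.
  by rewrite /n (big_rem I) //= leq_maxl.
have h_inj : {in r &, injective h}.
  move=> I J Ir Jr hIJ; apply: val_inj; apply/ffunP => i.
  by rewrite -(hE I i Ir) -(hE J i Jr) hIJ.
have uniq_hr : uniq (map h r) by rewrite map_inj_in_uniq.
apply: (@le_trans _ _ (\sum_(g : {ffun 'I_N -> 'I_n.+1}) \prod_i s ^+ g i)).
  rewrite [leRHS](bigID (mem (map h r))) /= -big_uniq // big_map -[leLHS]addr0 lerD //.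
    rewrite big_seq [leRHS]big_seq; apply: ler_sum => I Ir.
    rewrite /mi_deg -prodrXr le_eqVlt; apply/orP; left; apply/eqP.
    by apply: eq_bigr => i _; rewrite hE.
  by apply: sumr_ge0 => g _; apply: prodr_ge0 => i _; rewrite exprn_ge0 // ltW.
rewrite -(bigA_distr_bigA (fun (i : 'I_N) (j : 'I_n.+1) => s ^+ j)) /=.
rewrite prodr_const card_ord -exprVn lerXn2r ?nnegrE ?invr_ge0 ?subr_ge0 ?(ltW s_lt1) //.
  by apply: sumr_ge0 => j _; rewrite exprn_ge0 // ltW.
have := @geometric_le_lim R n.+1 1 s ler01 s_gt0; rewrite gtr0_norm // mul1r => /(_ s_lt1).
by apply: le_trans; rewrite /series /= big_mkord; apply: ler_sum => j _; rewrite mul1r.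
Qed.

(* Compare the l1 norms of the two sides of [v *m B = l *: v]. *)
Lemma eigenvalue_le_row_sum (R : realFieldType) N (B : 'M[R]_N) (r l : R) :
  (forall i j, 0 <= B i j) -> (forall i, \sum_j B i j <= r) ->
  eigenvalue B l -> l <= r.
Proof.
move=> B_ge0 rowB /eigenvalueP[v vB v_neq0].
have v_gt0 : 0 < \sum_i `|v 0 i|.
  rewrite lt0r sumr_ge0 // andbT; apply: contraNN v_neq0 => /eqP v0; apply/eqP/rowP => i.
  rewrite mxE; apply/eqP; rewrite -normr_eq0; apply/eqP.
  by move/psumr_eq0P: v0 => ->.
rewrite -(ler_pM2r v_gt0) big_distrr /=.
apply: (@le_trans _ _ (\sum_j \sum_i `|v 0 i| * B i j)).
  apply: ler_sum => j _; have := congr1 (fun w : 'rV_N => w 0 j) vB; rewrite !mxE => vBj.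
  apply: le_trans (ler_norm _) _; rewrite normrM normr_id -normrM -vBj.
  apply: le_trans (ler_norm_sum _ _ _) _; apply: ler_sum => i _.
  by rewrite normrM (ger0_norm (B_ge0 _ _)).
rewrite exchange_big big_distrr /=; apply: ler_sum => i _.
by rewrite -big_distrr /= mulrC ler_wpM2r.
Qed.

(* If [char_poly B] did not split, [spectrum B] would be [[::]] and [dfactor B = 1], so
   the spectral theorem is not needed. *)
Lemma dfactor_ge (R : realType) N (B : 'M[R]_N) (r : R) : 0 <= r < 1 ->
  (forall l, eigenvalue B l -> 0 <= l <= r) -> (1 - r) ^+ N <= dfactor B.
Proof.
move=> /andP[r_ge0 r_lt1] eigB; rewrite /dfactor /spectrum.
have q_ge0 : 0 <= 1 - r by lra.
case: xgetP => [s _ charB|_]; last by rewrite big_nil exprn_ile1 //; lra.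
have <- : size s = N.
  by apply: eq_add_S; rewrite -(size_char_poly B) charB (size_prod_XsubC s id).
have eig_s l : l \in s -> 0 <= l <= r.
  move=> ls; apply: eigB; rewrite eigenvalue_root_char charB root_prod_XsubC //.
elim: s {charB} eig_s => [|l s IH] eig_s; first by rewrite big_nil.
rewrite big_cons /= exprS.
have /andP[l_ge0 l_le] := eig_s l (mem_head _ _).
apply: ler_pM => //; first by rewrite exprn_ge0.
  (* (1 - r)^2 <= 1 - r^2 <= 1 - l^2. *)
  by rewrite -[leLHS]ger0_norm // -sqrtr_sqr ler_wsqrtr //; nra.
by apply: IH => k ks; apply: eig_s; rewrite inE ks orbT.
Qed.

Lemma exists_geometric_le (R : realType) (C s t : R) : 0 < s < 1 -> 0 < t ->
  exists n, C * s ^+ n <= t.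
Proof.
move=> /andP[s_gt0 s_lt1] t_gt0.
have s1 : `|s| < 1 by rewrite gtr0_norm.
have /cvgrPdist_lt/(_ _ t_gt0)[n _ hn] := @cvg_geometric R C s s1.
exists n; have := hn n (leqnn n); rewrite /= sub0r normrN => /ltW.
exact: le_trans (ler_norm _).
Qed.

(** The subtracted m^2 explains [Num.min c 1]: for c <= 1, c M - m^2 <= c (M - m^2); for c > 1, M -
    m^2 <= c (M - m^2) because m^2 <= M. *)
Lemma sample_size_le (R : realType) (c : R) (G : \bar R) (m M eps delta : R) :
  0 < c -> 0 < m -> m ^+ 2 <= M -> (G <= (Num.min c 1 * M)%:E)%E ->
  0 < eps -> 0 < delta ->
  (sample_size G m%:E eps delta <= c%:E * sample_size M%:E m%:E eps delta < +oo)%E.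
Proof.
move=> c_gt0 m_gt0 mM GM eps_gt0 delta_gt0; rewrite /sample_size.
have d_gt0 : 0 < delta * eps ^+ 2 * m ^+ 2 by rewrite !mulr_gt0 ?exprn_gt0.
rewrite -EFin_expe -EFinM -EFinB inver gt_eqF // -!EFinM ltry andbT mulrA EFinM.
rewrite lee_wpmul2r ?lee_fin ?invr_ge0 ?(ltW d_gt0) //.
apply: (@le_trans _ _ ((Num.min c 1 * M)%:E - (m ^+ 2)%:E)%E); first exact: leeB.
rewrite -EFinB lee_fin.
have m2_ge0 : 0 <= m ^+ 2 by rewrite sqr_ge0.
by case: (lerP c 1) => c1; nra.
Qed.

Lemma mi_fact_gt0 N (I : {ffun 'I_N -> nat}) : (0 < mi_fact I)%N.
Proof. by apply: prodn_gt0 => k; exact: fact_gt0. Qed.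

(** * Bounds on the mean and the second moments *)

Section QBounds.
Variables (R : realType) (N : nat) (K : option nat).
Variables (a : coef_space R N K) (B : 'M[R]_N).

Lemma QMC_ge I : (forall I, 0 <= a I) ->
  (forall I, ~~ odd (mi_deg I) -> 0 <= haf_rep B I) ->
  ((a I ^+ 2 * haf_rep B (mi_add (val I) (val I)))%:E <= QMC a B)%E.
Proof.
move=> a_ge0 h_ge0; apply: esum_ge; exists [set (I, I)].
  by split => //; exact: finite_set1.
by rewrite fsbig_set1 expr2.
Qed.

(** Since h^2 <= I! gives h <= I!/h, one geometric majorant serves both [mu] and the series in
    [QGBSP]; their product produces the square. *)
Lemma mu_QGBSP_le (s T d : R) : 0 < s < 1 -> 0 <= T -> 0 < d <= dfactor B ->
  (forall I, 0 <= a I) ->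
  (forall I, ~~ odd (mi_deg I) -> 0 < haf_rep B I /\ haf_rep B I ^+ 2 <= (mi_fact I)%:R) ->
  (forall I, a I * ((mi_fact (val I))%:R / haf_rep B (val I)) <= T * s ^+ mi_deg (val I)) ->
  (mu a B <= (T / (1 - s) ^+ N)%:E)%E /\
  (QGBSP a B <= ((T / (1 - s) ^+ N) ^+ 2 / d)%:E)%E.
Proof.
move=> s01 T_ge0 /andP[d_gt0 dle] a_ge0 hB aT.
have evI (I : mindex N K) : ~~ odd (mi_deg (val I)) by have /andP[] := valP I.
have mu_ge0 : (0 <= mu a B)%E.
  apply: esum_ge0 => I _; have [h _] := hB _ (evI I).
  by rewrite lee_fin mulr_ge0 // ltW.
have mu_le : (mu a B <= (T / (1 - s) ^+ N)%:E)%E.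
  apply: esum_geometric_le => // I; apply: le_trans (aT I).
  have [h_gt0 h_le] := hB _ (evI I).
  by rewrite ler_wpM2l // ler_pdivlMr // -expr2.
have dfac_gt0 : 0 < dfactor B by exact: lt_le_trans dle.
set T' := T / (1 - s) ^+ N in mu_le *.
split=> //; rewrite (_ : T' ^+ 2 / d = T' * d^-1 * T'); last by rewrite expr2 mulrAC.
rewrite /QGBSP !EFinM; apply: lee_pmul.
- by rewrite mule_ge0 // lee_fin invr_ge0 ltW.
- apply: esum_ge0 => I _; have [h_gt0 _] := hB _ (evI I).
  by rewrite lee_fin; apply: divr_ge0 (ltW h_gt0); rewrite mulr_ge0.
- by apply: lee_pmul => //; rewrite lee_fin ?invr_ge0 ?(ltW dfac_gt0) // lef_pV2 ?posrE.
- by apply: esum_geometric_le => // I; rewrite -mulrA.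
Qed.
End QBounds.

Section KeyInequality.
Variables (R : realType) (N : nat) (K : option nat).
Variables (a : coef_space R N K) (B : 'M[R]_N) (beta eps tau d A : R) (L : nat) (I0 : mindex N K).
Hypotheses (eps_gt0 : 0 < eps) (eps_le1 : eps <= 1) (beta_gt0 : 0 < beta) (beta_lt1 : beta < 1)
  (beta_big : 4 / 5 <= beta ^+ 8).
Hypotheses (B_diag : forall i, beta <= B i i) (B_ge : forall i j, eps <= B i j)
  (rowB : forall i, \sum_j B i j <= 1) (colB : forall j, \sum_i B i j <= 1).
Hypotheses (d_gt0 : 0 < d) (dle : d <= dfactor B) (tau_gt0 : 0 < tau).
Hypothesis L_big : (2 / eps) ^+ N * beta ^+ L <= tau.

(** This stands in for Haf(B_I), which it bounds from below, so that the conditions on the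
    coefficients do not involve [B]. *)
Definition weight_prod (I : {ffun 'I_N -> nat}) : R := \prod_k haf_weight beta eps (I k).

Hypotheses (a_ge0 : forall I, 0 <= a I)
  (a_low : forall I, (mi_deg (val I) < L)%N ->
    a I <= tau * beta ^+ mi_deg (val I) * weight_prod (val I) / (mi_fact (val I))%:R)
  (a_I0 : 1 <= a I0 ^+ 2 * weight_prod (mi_add (val I0) (val I0)))
  (QMC_fin : (QMC a B < +oo)%E).

Lemma weight_prod_gt0 I : 0 < weight_prod I.
Proof. by apply: prodr_gt0 => k _; exact: haf_weight_gt0. Qed.

(** With T = tau sqrt(Q^MC), every a_I I!/h_I is at most T beta^|I|: in low degree by the smallness
    of the coefficients, in high degree by the diagonal terms of Q^MC. *)
Lemma mu_QGBSP_le_QMC :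
  (mu a B ^+ 2 <= ((tau / (1 - beta) ^+ N) ^+ 2)%:E * QMC a B)%E /\
  (QGBSP a B <= ((tau / (1 - beta) ^+ N) ^+ 2 / d)%:E * QMC a B)%E.
Proof.
have evI (I : mindex N K) : ~~ odd (mi_deg (val I)) by have /andP[] := valP I.
have ev2 (I : mindex N K) : ~~ odd (mi_deg (mi_add (val I) (val I))).
  by rewrite mi_deg_add oddD addbb.
have B_ge0 i j : 0 <= B i j by exact: le_trans (ltW eps_gt0) (B_ge i j).
have h_gt0 I : ~~ odd (mi_deg I) -> 0 < haf_rep B I.
  exact: (haf_rep_gt0 eps_gt0 eps_le1 beta_gt0 (ltW beta_lt1) B_diag B_ge).
have h_ge I : ~~ odd (mi_deg I) -> weight_prod I <= haf_rep B I.
  exact: (haf_rep_ge eps_gt0 eps_le1 beta_gt0 (ltW beta_lt1) B_diag B_ge).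
have M_ge I := QMC_ge I a_ge0 (fun J ev => ltW (h_gt0 J ev)).
(* The term at [I0] forces Q^MC >= 1, so that sqrt(M) can be inserted in the low-degree bound. *)
have M_ge1 : (1 <= QMC a B)%E.
  apply: le_trans (M_ge I0); rewrite lee_fin; apply: le_trans a_I0 _.
  by rewrite ler_wpM2l ?sqr_ge0 ?h_ge.
have [M ME] : exists M, QMC a B = M%:E.
  exists (fine (QMC a B)); rewrite fineK // ge0_fin_numE //.
  exact: le_trans M_ge1.
rewrite ME !lee_fin in M_ge1 M_ge *.
have M_ge0 : 0 <= M by exact: le_trans M_ge1.
pose T := tau * Num.sqrt M.
have T_ge0 : 0 <= T by rewrite mulr_ge0 ?sqrtr_ge0 ?(ltW tau_gt0).
have aT I : a I * ((mi_fact (val I))%:R / haf_rep B (val I)) <= T * beta ^+ mi_deg (val I).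
  have x_ge0 : 0 <= (mi_fact (val I))%:R / haf_rep B (val I).
    by rewrite divr_ge0 // ltW // h_gt0.
  have b_ge0 : 0 <= beta ^+ mi_deg (val I) by rewrite exprn_ge0 // ltW.
  have [lowI|highI] := ltnP (mi_deg (val I)) L.
    apply: (@le_trans _ _ (tau * beta ^+ mi_deg (val I))); last first.
      rewrite ler_wpM2r // ler_peMr ?(ltW tau_gt0) //.
      by rewrite -sqrtr1 ler_wsqrtr.
    apply: le_trans (ler_wpM2r x_ge0 (a_low lowI)) _.
    have f_neq0 : (mi_fact (val I))%:R != 0 :> R by rewrite pnatr_eq0 -lt0n mi_fact_gt0.
    rewrite mulrA divfK // ler_pdivrMr ?h_gt0 // ler_wpM2l ?h_ge //.
    by rewrite mulr_ge0 // ltW.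
  (* In [t], one factor beta^|I| together with (2 / eps)^N is at most [tau] by [L_big]; the other is
     kept. *)
  pose t := (2 / eps) ^+ N * beta ^+ mi_deg (val I) ^+ 2.
  have C_ge0 : 0 <= (2 / eps) ^+ N by rewrite exprn_ge0 // divr_ge0 // ltW.
  have t_ge0 : 0 <= t by rewrite mulr_ge0 ?sqr_ge0.
  apply: (@le_trans _ _ (Num.sqrt M * t)).
    rewrite -(ger0_norm (mulr_ge0 (a_ge0 I) x_ge0)) -sqrtr_sqr -(ger0_norm t_ge0) -sqrtr_sqr.
    rewrite -sqrtrM // ler_wsqrtr // exprMn mulrC.
    apply: (@le_trans _ _ (t ^+ 2 * haf_rep B (mi_add (val I) (val I)) * a I ^+ 2)).
      rewrite ler_wpM2r ?sqr_ge0 //.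
      exact: (haf_rep_ratio eps_gt0 eps_le1 beta_gt0 (ltW beta_lt1) B_diag B_ge beta_big).
    rewrite -mulrA [leRHS]mulrC ler_wpM2l ?sqr_ge0 // mulrC -lee_fin; exact: M_ge.
  rewrite /T [tau * _]mulrC -[leRHS]mulrA ler_wpM2l ?sqrtr_ge0 //.
  rewrite /t expr2 mulrA ler_wpM2r //; apply: le_trans L_big; rewrite ler_wpM2l //.
  by rewrite ler_wiXn2l // ltW.
have [mu_le Q_le] : _ /\ _ :=
  @mu_QGBSP_le R N K a B beta T d (introT andP (conj beta_gt0 beta_lt1)) T_ge0
   (introT andP (conj d_gt0 dle)) a_ge0
   (fun J ev => conj (h_gt0 J ev) (haf_rep_sqr_le B_ge0 rowB colB ev (ltW (h_gt0 J ev)))) aT.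
have TE : (T / (1 - beta) ^+ N) ^+ 2 = (tau / (1 - beta) ^+ N) ^+ 2 * M.
  by rewrite /T mulrAC exprMn sqr_sqrtr.
split; last by rewrite -EFinM mulrAC -TE.
rewrite -EFinM -TE EFin_expe lee_sqr //.
  by apply: esum_ge0 => I _; rewrite lee_fin mulr_ge0 // ltW // h_gt0.
by rewrite lee_fin divr_ge0 // exprn_ge0 // subr_ge0 ltW.
Qed.
End KeyInequality.

(** * The open set *)

Lemma finite_mindex_deg_lt N K D : finite_set [set I : mindex N K | (mi_deg (val I) < D)%N].
Proof.
have [->|/set0P[I0 _]] := eqVneq [set I : mindex N K | (mi_deg (val I) < D)%N] set0.
  exact: finite_set0.
pose u (g : {ffun 'I_N -> 'I_D}) : mindex N K :=
  insubd (I0 : {I | even_upto K I}) [ffun k => nat_of_ord (g k)].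
apply: (@sub_finite_set _ _ (u @` setT)); last by apply: finite_image.
move=> I /= ltI; have lt_k k : (val I k < D)%N.
  by apply: leq_ltn_trans ltI; rewrite /mi_deg (bigD1 k) //= leq_addr.
exists [ffun k => Ordinal (lt_k k)] => //; rewrite /u.
have -> : [ffun k => nat_of_ord ([ffun k' => Ordinal (lt_k k')] k)] = val I.
  by apply/ffunP => k; rewrite !ffunE.
exact: valKd.
Qed.

Section ConstantOffDiagonal.
Variables (R : realFieldType) (N : nat) (x y : R).

Definition diag_off : 'M[R]_N := (x - y)%:M + const_mx y.

Lemma diag_offE i j : diag_off i j = if i == j then x else y.
Proof. by rewrite !mxE; case: eqP => _; rewrite ?mulr1n ?mulr0n ?subrK ?add0r. Qed.

(** Let S be the sum of the entries of an eigenvector. Summing the coordinates of the eigenvalue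
    equation gives the second value if S is nonzero; if S = 0, a nonzero entry gives the first. *)
Lemma eigenvalue_diag_off l : eigenvalue diag_off l ->
  l = x - y \/ l = x - y + N%:R * y.
Proof.
move=> /eigenvalueP[v vB v_neq0]; pose S := \sum_i v 0 i.
have vBj j : (x - y) * v 0 j + y * S = l * v 0 j.
  have := congr1 (fun w : 'rV_N => w 0 j) vB; rewrite mulmxDr mul_mx_scalar !mxE => <-.
  by congr (_ + _); rewrite mulrC big_distrl; apply: eq_bigr => i _; rewrite mxE.
have [S0|S_neq0] := eqVneq S 0.
  left; have [j vj] : exists j, v 0 j != 0.
    by apply/existsP; apply: contraNT v_neq0; rewrite negb_exists => /forallP v0;
      apply/eqP/rowP => j; rewrite mxE; apply/eqP; rewrite -[_ == _]negbK v0.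
  by apply: (mulIf vj); rewrite -vBj S0 mulr0 addr0.
right; apply: (mulIf S_neq0).
have : \sum_j ((x - y) * v 0 j + y * S) = \sum_j l * v 0 j by apply: eq_bigr.
rewrite big_split -!big_distrr /= sumr_const card_ord -/S -mulr_natl => <-.
by ring.
Qed.
End ConstantOffDiagonal.

Section OpenBox.
Variables (R : realType) (N : nat) (K : option nat).

Definition coef_box (A : R) (I0 : mindex N K) (D : nat) (eta : mindex N K -> R)
    (lo hi : 'M[R]_N) : set (coef_space R N K * 'M[R]_N) :=
  [set aB : coef_space R N K * 'M[R]_N |
    [/\ A < aB.1 I0, (forall I : mindex N K, (mi_deg (val I) < D)%N -> aB.1 I < eta I)
      & forall i j, lo i j < aB.2 i j < hi i j]].

(** Only finitely many indices have degree below [D], so the box is cut out by finitely many strict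
    inequalities on continuous coordinates, even for infinite [K]. *)
Lemma open_coef_box A I0 D eta lo hi : open (coef_box A I0 D eta lo hi).
Proof.
have coef_cont I : continuous (fun aB : coef_space R N K * 'M[R]_N => aB.1 I).
  move=> aB; apply: (@continuous_comp _ _ _ fst (fun a : coef_space R N K => a I)).
    exact: cvg_fst.
  exact: (@proj_continuous (mindex N K) (fun=> R) I).
have mx_cont i j : continuous (fun aB : coef_space R N K * 'M[R]_N => aB.2 i j).
  move=> aB; apply: (@continuous_comp _ _ _ snd (fun B : 'M[R]_N => B i j)).
    exact: cvg_snd.
  exact: coord_continuous.
have open_fin (T : choiceType) (E : set T) (F : T -> set (coef_space R N K * 'M[R]_N)) :
    finite_set E -> (forall i, E i -> open (F i)) -> open (\bigcap_(i in E) F i).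
  move=> finE oF; rewrite -closedC setC_bigcap; apply: closed_bigcup => // i Ei.
  by rewrite closedC; exact: oF.
pose low := [set I : mindex N K | (mi_deg (val I) < D)%N].
have -> : coef_box A I0 D eta lo hi =
   [set aB : coef_space R N K * 'M[R]_N | A < aB.1 I0] `&`
   (\bigcap_(I in low) [set aB : coef_space R N K * 'M[R]_N | aB.1 I < eta I] `&`
    \bigcap_(ij in [set: 'I_N * 'I_N])
     ([set aB : coef_space R N K * 'M[R]_N | lo ij.1 ij.2 < aB.2 ij.1 ij.2] `&`
      [set aB : coef_space R N K * 'M[R]_N | aB.2 ij.1 ij.2 < hi ij.1 ij.2])).
  apply/seteqP; split => [aB [h1 h2 h3]|aB [h1 [h2 h3]]].
    by split => //; split => [I /h2 //|[i j] _ /=]; apply/andP.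
  by split => // i j; apply/andP; exact: (h3 (i, j)).
apply: openI; last apply: openI.
- exact: (open_comp (in1W (coef_cont I0)) (@open_gt _ A)).
- apply: open_fin => [|I _]; first exact: finite_mindex_deg_lt.
  exact: (open_comp (in1W (coef_cont I)) (@open_lt _ (eta I))).
- apply: open_fin => [|[i j] _]; first exact: (@finite_finset ('I_N * 'I_N)%type).
  apply: openI.
    exact: (open_comp (in1W (mx_cont i j)) (@open_gt _ (lo i j))).
  exact: (open_comp (in1W (mx_cont i j)) (@open_lt _ (hi i j))).
Qed.
End OpenBox.

(** A single nonzero coefficient leaves one term in each series, so the finiteness conditions hold
    for infinite [K] as well. *)
Lemma problem_space_delta (R : realType) N K (I0 : mindex N K) (z : R) (B : 'M[R]_N) :
  admissible B -> 0 < z -> 0 < haf_rep B (val I0) ->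
  0 <= haf_rep B (mi_add (val I0) (val I0)) ->
  problem_space R N K ((fun I => if I == I0 then z else 0), B).
Proof.
move=> admB z_gt0 h_gt0 h2_ge0; pose a I := if I == I0 then z else 0 : R.
have aI0 : a I0 = z by rewrite /a eqxx.
have a0 I : I != I0 -> a I = 0 by rewrite /a => /negPf ->.
split => //=.
- by move=> I; rewrite -/(a I) /a; case: ifP => // _; exact: ltW.
- rewrite /mu (@esum_supp1 _ _ I0 (fun I => a I * haf_rep B (val I))) /= ?aI0.
  + by rewrite ltry; split => //; rewrite eqe mulf_neq0 // gt_eqF.
  + by rewrite mulr_ge0 // ltW.
  + by move=> I /a0 ->; rewrite mul0r.
- rewrite /sum_fact (@esum_supp1 _ _ I0
    (fun I => a I * (mi_fact (val I))%:R * haf_rep B (val I))) /= ?aI0 ?ltry //.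
  + by apply: mulr_ge0 (ltW h_gt0); rewrite mulr_ge0 // ltW.
  + by move=> I /a0 ->; rewrite !mul0r.
- rewrite /QMC (@esum_supp1 _ _ (I0, I0) (fun IJ => a IJ.1 * a IJ.2 *
     haf_rep B (mi_add (val IJ.1) (val IJ.2)))) /= ?aI0 ?ltry //.
  + by apply: mulr_ge0 h2_ge0; rewrite mulr_ge0 // ltW.
  + move=> [I J] /=; rewrite xpair_eqE negb_and => /orP[] /a0 ->; first by rewrite !mul0r.
    by rewrite mulr0 mul0r.
Qed.

Lemma sum_diag_off (R : realFieldType) N (x y : R) i :
  \sum_j diag_off N x y i j = x - y + N%:R * y.
Proof.
under eq_bigr do rewrite !mxE.
rewrite big_split /= sumr_const card_ord mulr_natl; congr (_ + _).
by rewrite (bigD1 i) //= eqxx big1 ?addr0 // => j /negPf; rewrite eq_sym => ->.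
Qed.

Lemma even_mindex N K n : (0 < N)%N -> le_cutoff n K ->
  exists I : mindex N K, mi_deg (val I) = n.*2.
Proof.
move=> N_gt0 nK; pose i0 := Ordinal N_gt0.
pose v : {ffun 'I_N -> nat} := [ffun i => if i == i0 then n.*2 else 0%N].
have vdeg : mi_deg v = n.*2.
  rewrite /mi_deg (bigD1 i0) //= ffunE eqxx big1 ?addn0 // => i /negPf i_neq.
  by rewrite ffunE i_neq.
have evv : even_upto K v by rewrite /even_upto vdeg odd_double doubleK.
by exists (Sub v evv).
Qed.

Lemma admissible_diag_off (R : realType) N (x y : R) : 0 < y < x ->
  x - y + N%:R * y < 1 -> admissible (diag_off N x y).
Proof.
move=> /andP[y_gt0 yx] xNy_lt1.
have Ny_ge0 : 0 <= N%:R * y by rewrite mulr_ge0 // ltW.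
split.
- by rewrite linearD /= tr_scalar_mx trmx_const.
- by move=> i j; rewrite diag_offE; case: eqP => // _; exact: lt_trans yx.
- by move=> l /eigenvalue_diag_off[] ->; apply/andP; split; lra.
Qed.

Lemma ltr_diag_off (R : realFieldType) N (x y x' y' : R) i j : x < x' -> y < y' ->
  diag_off N x y i j < diag_off N x' y' i j.
Proof. by rewrite !diag_offE; case: eqP. Qed.

Theorem theorem1p7 (R : realType) (c : R) (hc : 0 < c) (N : nat)
    (hN : (0 < N)%N) :
  exists K0 : nat, forall K : option nat, le_cutoff K0 K ->
    exists U : set (subspace (problem_space R N K)),
      [/\ U `<=` problem_space R N K, U !=set0, open U
        & forall aB, U aB -> forall eps delta : R,
            0 < eps < 1 -> 0 < delta < 1 ->
            (nGBSP aB.1 aB.2 eps delta <= c%:E * nMC aB.1 aB.2 eps delta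
               < +oo)%E].
Proof.
have N_ge1 : 1 <= N%:R :> R by rewrite ler1n.
(* [b] is close enough to 1 that b^8 >= 4/5, and [e] small enough that the upper corner [hi] has row
   sums at most 99/100 for every [N]. *)
have [b bE] : exists b : R, b = 49 / 50 by exists (49 / 50).
have [e eN] : exists e : R, N%:R * e = 1 / 400.
  by exists (1 / 400 / N%:R); rewrite mulrC divfK // pnatr_eq0 -lt0n.
(* Row sums at most 99/100 make [d] a lower bound of [dfactor] on the whole box. *)
have [d dE] : exists d : R, d = (1 - 99 / 100) ^+ N by exists ((1 - 99 / 100) ^+ N).
(* With this [tau] the final factor on Q^MC is (d c')^2 / d = d c'^2 <= c'. *)
pose c' := Num.min c 1; pose tau := (1 - b) ^+ N * (d * c').
have e_gt0 : 0 < e by rewrite -(pmulr_rgt0 _ (lt_le_trans ltr01 N_ge1)) eN; lra.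
have e_le : e <= 1 / 400 by rewrite -eN ler_peMl // ltW.
have b_gt0 : 0 < b by lra.
have b_lt1 : b < 1 by lra.
have b8 : 4 / 5 <= b ^+ 8.
  have b2 : 96 / 100 <= b ^+ 2 by rewrite bE expr2; lra.
  have b4 : 92 / 100 <= b ^+ 4 by rewrite (exprM b 2 2) expr2; nra.
  by rewrite (exprM b 4 2) expr2; nra.
have d_gt0 : 0 < d by rewrite dE exprn_gt0 //; lra.
have d_le1 : d <= 1 by rewrite dE exprn_ile1 //; lra.
have c'_gt0 : 0 < c' by rewrite lt_min hc ltr01.
have c'_le1 : c' <= 1 by rewrite ge_min lexx orbT.
have q_gt0 : 0 < (1 - b) ^+ N by rewrite exprn_gt0 // subr_gt0.
have tau_gt0 : 0 < tau by rewrite !mulr_gt0.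
have tauE : tau / (1 - b) ^+ N = d * c' by rewrite /tau mulrAC divff ?mul1r // gt_eqF.
have [n hn] := @exists_geometric_le R ((2 / e) ^+ N) b tau (introT andP (conj b_gt0 b_lt1)) tau_gt0.
(* The degree of [I0] equals the threshold 2n, so its large coefficient is not among those of degree
   below 2n required to be small. *)
exists n => K nK; have [I0 I0deg] := even_mindex hN nK.
pose lo := diag_off N b e; pose hi := diag_off N (986 / 1000) (16 / 10 * e).
pose w := weight_prod b e (mi_add (val I0) (val I0)).
have w_gt0 : 0 < w by exact: weight_prod_gt0.
pose eta (I : mindex N K) :=
  tau * b ^+ mi_deg (val I) * weight_prod b e (val I) / (mi_fact (val I))%:R.
(* For any w > 0, a coefficient above 1 + 1/w at [I0] has square times w at least 1. *)
pose V := coef_box (1 + w^-1) I0 n.*2 eta lo hi.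
(* The midpoint of the box, an admissible matrix that witnesses non-emptiness. *)
pose B0 := diag_off N (983 / 1000) (13 / 10 * e).
have loB (B : 'M[R]_N) : (forall i j, lo i j < B i j < hi i j) ->
    [/\ forall i, b <= B i i, forall i j, e <= B i j & forall i, \sum_j B i j <= 99 / 100].
  move=> Bbox; split.
  - by move=> i; have /andP[] := Bbox i i; rewrite diag_offE eqxx => /ltW.
  - move=> i j; have /andP[+ _] := Bbox i j; rewrite diag_offE; case: eqP => _ /ltW //.
    by apply: le_trans; lra.
  - move=> i; apply: (@le_trans _ _ (\sum_j hi i j)).
      by apply: ler_sum => j _; have /andP[_ /ltW] := Bbox i j.
    by rewrite sum_diag_off; lra.
exists (V `&` problem_space R N K : set (subspace (problem_space R N K))); split.
- exact: subIsetr.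
- pose z := 2 + w^-1.
  exists ((fun I => if I == I0 then z else 0), B0).
  have z_gt0 : 0 < z by rewrite addr_gt0 // invr_gt0.
  have boxB0 i j : lo i j < B0 i j < hi i j.
    by apply/andP; split; apply: ltr_diag_off; lra.
  have [Bd Be _] := loB B0 boxB0.
  have h_gt0 I : ~~ odd (mi_deg I) -> 0 < haf_rep B0 I.
    by apply: (haf_rep_gt0 e_gt0 _ b_gt0 (ltW b_lt1) Bd Be); lra.
  split.
  + split => //=.
    * by rewrite eqxx /z; lra.
    * move=> I ltI; rewrite ifN; last by apply: contraTneq ltI => ->; rewrite I0deg ltnn.
      by rewrite divr_gt0 ?ltr0n ?mi_fact_gt0 // mulr_gt0 ?weight_prod_gt0 // mulr_gt0 ?exprn_gt0.
  + apply: problem_space_delta => //.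
    * by apply: admissible_diag_off; [apply/andP; split; lra | lra].
    * by apply: h_gt0; rewrite I0deg odd_double.
    * by apply/ltW/h_gt0; rewrite mi_deg_add oddD addbb.
- by rewrite open_subspaceIT; apply: open_subspaceW; exact: open_coef_box.
move=> [a B] [/= [/= a_I0 a_low Bbox] [/= [Bsym Bpos Beig] a_ge0 [mu_neq0 mu_fin] _ QMC_fin]].
move=> eps delta /andP[eps_gt0 _] /andP[delta_gt0 _].
have [Bd Be rowB] := loB B Bbox.
have rowB1 i : \sum_j B i j <= 1 by apply: le_trans (rowB i) _; lra.
have colB1 j : \sum_i B i j <= 1.
  by rewrite -[B]Bsym; under eq_bigr do rewrite mxE.
have B_ge0 i j : 0 <= B i j by exact: ltW.
have dle : d <= dfactor B.
  rewrite dE; apply: dfactor_ge => [|l eigl]; first by lra.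
  have /andP[/ltW -> _] := Beig l eigl.
  exact: eigenvalue_le_row_sum eigl.
have e_le1 : e <= 1 by lra.
have Dbig : (2 / e) ^+ N * b ^+ n.*2 <= tau.
  apply: le_trans hn; rewrite ler_wpM2l ?exprn_ge0 ?divr_ge0 ?(ltW e_gt0) //.
  by rewrite ler_wiXn2l ?(ltW b_gt0) ?(ltW b_lt1) // -addnn leq_addr.
have a_I0' : 1 <= a I0 ^+ 2 * w.
  have := mulVf (lt0r_neq0 w_gt0); have : 0 < w^-1 by rewrite invr_gt0.
  by move: a_I0; set u := w^-1; nra.
have [mu_le Q_le] := mu_QGBSP_le_QMC e_gt0 e_le1 b_gt0 b_lt1 b8 Bd Be rowB1 colB1
  d_gt0 dle tau_gt0 Dbig a_ge0 (fun I lt => ltW (a_low I lt)) a_I0' QMC_fin.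
rewrite tauE in mu_le Q_le.
have h_gt0 I : ~~ odd (mi_deg I) -> 0 < haf_rep B I.
  exact: (haf_rep_gt0 e_gt0 e_le1 b_gt0 (ltW b_lt1) Bd Be).
have mu_ge0 : (0 <= mu a B)%E.
  apply: esum_ge0 => I _; rewrite lee_fin mulr_ge0 // ltW // h_gt0 //.
  by have /andP[] := valP I.
have QMC_ge0 : (0 <= QMC a B)%E.
  apply: le_trans (QMC_ge I0 a_ge0 (fun J ev => ltW (h_gt0 J ev))).
  by rewrite lee_fin mulr_ge0 ?sqr_ge0 // ltW // h_gt0 // mi_deg_add oddD addbb.
have [m mE] : exists m, mu a B = m%:E by exists (fine (mu a B)); rewrite fineK // ge0_fin_numE.
have [M ME] : exists M, QMC a B = M%:E by exists (fine (QMC a B)); rewrite fineK // ge0_fin_numE.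
rewrite /nGBSP /nMC /= mE ME.
rewrite mE ME in mu_le Q_le mu_neq0 mu_ge0 QMC_ge0.
rewrite -EFin_expe -!EFinM !lee_fin eqe in mu_le mu_neq0 mu_ge0 QMC_ge0.
apply: sample_size_le => //.
- by rewrite lt0r mu_neq0.
- apply: le_trans mu_le _; rewrite ler_piMl // exprn_ile1 //; first by rewrite mulr_ge0 // ltW.
  by rewrite mulr_ile1 // ltW.
apply: le_trans Q_le _; rewrite -EFinM lee_fin ler_wpM2r // -/c'.
have -> : (d * c') ^+ 2 / d = d * c' * c' by field; rewrite gt_eqF.
by rewrite ler_piMl ?(ltW c'_gt0) // mulr_ile1 // ltW.
Qed.
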